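(* Let $\mathbf{h}$ be a weakly increasing sequence of positive integers with $\mathbf{h}(i)>i$ for all $i$, let $S$ be a nonempty $\mathbf{h}$-admissible set and $m=\mathbf{m}(S)$. For all $n\ge\mathbf{h}(m)$, $$\mathcal{I}_\mathbf{h}(S,n;q)=\sum_{k=\mathbf{h}(m)-m}^{\mathbf{h}(m)} b_k(S;q)\begin{bmatrix} n-k\\ \mathbf{h}(m)-k\end{bmatrix}_q=\sum_{\ell=0}^{m} b_{\mathbf{h}(m)-\ell}(S;q)\begin{bmatrix} n-\mathbf{h}(m)+\ell\\ \ell\end{bmatrix}_q,$$ where $b_k(S;q)=\sum_{\pi\in B_k(S,\mathbf{h}(m))}q^{\ell(\pi)}$.
   Context: $\mathcal{P}_\mathbf{h}=\{(i,j): i<j\le \mathbf{h}(i)\}$. For $\pi\in S_n$, $\mathrm{inv}_\mathbf{h}(\pi)=\{(i,j)\in\mathcal{P}_\mathbf{h}: j\le n,\ \pi_i>\pi_j\}$. $S$ is $\mathbf{h}$-admissible if $S=\mathrm{inv}_\mathbf{h}(\pi)$ for some permutation $\pi$. $I_\mathbf{h}(S,n)=\{\pi\in S_n:\mathrm{inv}_\mathbf{h}(\pi)=S\}$. $\mathbf{m}(S)=\max\{i:(i,i+1)\in S\}$. $B_k(S,n)=\{\pi\in I_\mathbf{h}(S,n):\pi_{\mathbf{h}(m)}=k\}$. $\ell(\pi)$ is the number of inversions of $\pi$. $\mathcal{I}_\mathbf{h}(S,n;q)=\sum_{\pi\in I_\mathbf{h}(S,n)}q^{\ell(\pi)}$.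 The $q$-binomial coefficient is $\begin{bmatrix} n\\ k\end{bmatrix}_q=\frac{[n]!_q}{[n-k]!_q[k]!_q}$ with $[n]!_q=\prod_{r=1}^{n}(1+q+\cdots+q^{r-1})$. *)

(* Defs.v *)
From mathcomp Require Import all_boot all_order all_algebra all_fingroup.
From mathcomp Require Import finmap.

Set Implicit Arguments.
Unset Strict Implicit.
Unset Printing Implicit Defensive.

Import GRing.Theory.

(* Positions and values of permutations, and the arguments of h, start at 1.
   Hence h : nat -> nat stands for the sequence h 1, h 2, ...; the value h 0 is
   never constrained and never used. *)

Section Inversions.
Variable h : nat -> nat.

Definition Ph : {pred nat * nat} := [pred p | 0 < p.1 < p.2 & p.2 <= h p.1].

Section OneSize.
Variable n : nat.
Implicit Type pi : 'S_n.

(* pi_i for 1 <= i <= n, where 'S_n acts on {0, ..., n-1}. *)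
Definition oneline pi (i : nat) : nat :=
  oapp (fun x : 'I_n => (pi x).+1) 0 (insub i.-1).

Definition inv_h pi : {fset nat * nat} :=
  [fset p in [seq (i, j) | i <- iota 1 n, j <- iota 1 n]
     | (p \in Ph) && (oneline pi p.2 < oneline pi p.1)]%fset.

Definition len pi : nat :=
  #|[set p : 'I_n * 'I_n | (p.1 < p.2) && (pi p.2 < pi p.1)]|.

End OneSize.

(* Every inv_h pi is finite, so an admissible set is a finite set of pairs. *)
Definition admissible (S : {fset nat * nat}) : Prop :=
  exists (n : nat) (pi : 'S_n), S = inv_h pi.

Definition I_h (S : {fset nat * nat}) (n : nat) : {set 'S_n} :=
  [set pi : 'S_n | inv_h pi == S].

(* max {i : (i, i+1) \in S}; this set is nonempty if S is nonempty and
   admissible and h i > i for all i. *)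
Definition max_descent (S : {fset nat * nat}) : nat :=
  \max_(p <- S | p.2 == p.1.+1) p.1.

Definition B_h (S : {fset nat * nat}) (k n : nat) : {set 'S_n} :=
  [set pi in I_h S n | oneline pi (h (max_descent S)) == k].

Local Open Scope ring_scope.

Definition I_poly (S : {fset nat * nat}) (n : nat) : {poly int} :=
  \sum_(pi in I_h S n) 'X^(len pi).

Definition b_poly (S : {fset nat * nat}) (k : nat) : {poly int} :=
  \sum_(pi in B_h S k (h (max_descent S))) 'X^(len pi).

End Inversions.

Local Open Scope ring_scope.

Definition qfact (n : nat) : {poly int} :=
  \prod_(1 <= r < n.+1) \sum_(0 <= i < r) 'X^i.

(* The quotient is formed in the field of rational functions in q = 'X. *)
Definition qbinom (n k : nat) : {fraction {poly int}} :=
  tofrac (qfact n) / (tofrac (qfact (n - k)) * tofrac (qfact k)).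

(* Main.v *)
(** Put M = h m. A permutation in I_h(S, n) increases from position m + 1 on, and
    for n >= M a permutation of size n + 1 lies in I_h(S, n + 1) exactly when its
    last step is an ascent and deleting its last entry (and standardizing) gives an
    element of I_h(S, n). Since the entry k at position M does not exceed the last
    entry, it survives this deletion. So the generating function
    D(n, k, v) of the pi in I_h(S, n) with pi_M = k and pi_n <= v satisfies
      D(n + 1, k, v) = \sum_(j < v) q^(n - j) D(n, k, j),
    and the q-Pascal rule solves this recursion as
      D(n, k, k + a) = b_k q^((n - M)(n - k - a)) [a choose n - M]_q.
    The theorem is the case k + a = n, summed over k. *)

Require Import Defs.
From mathcomp Require Import all_boot all_order all_algebra all_fingroup.
From mathcomp Require Import finmap zify ring.
Import GRing.Theory.
Local Open Scope ring_scope.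

Set Implicit Arguments.
Unset Strict Implicit.

(** * Gaussian binomials as polynomials *)

Fixpoint gauss (a r : nat) : {poly int} :=
  match a, r with
  | _, 0%N => 1
  | 0%N, _.+1 => 0
  | a'.+1, r'.+1 => gauss a' r' + 'X^(r'.+1) * gauss a' r'.+1
  end.

Lemma gauss0 a : gauss a 0 = 1. Proof. by case: a. Qed.

Lemma gaussS a r : gauss a.+1 r.+1 = gauss a r + 'X^(r.+1) * gauss a r.+1.
Proof. by []. Qed.

Lemma gauss_small a r : (a < r)%N -> gauss a r = 0.
Proof.
elim: a r => [|a IH] [|r] //= lt_ar.
by rewrite !IH ?mulr0 ?addr0 //; lia.
Qed.

Lemma qfact0 : qfact 0 = 1.
Proof. by rewrite /qfact big_geq. Qed.

Lemma qfactS r : qfact r.+1 = qfact r * \sum_(0 <= i < r.+1) 'X^i.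
Proof. by rewrite /qfact big_nat_recr. Qed.

Lemma qnumD a b : \sum_(0 <= i < a + b) 'X^i =
  \sum_(0 <= i < a) 'X^i + 'X^a * \sum_(0 <= i < b) 'X^i :> {poly int}.
Proof.
rewrite (big_cat_nat (n := a)) //=; last exact: leq_addr.
congr (_ + _); rewrite -{1}[a]add0n big_addn addKn mulr_sumr.
by apply: eq_bigr => i _; rewrite -exprD addnC.
Qed.

(** Stated without division, so that it lives in [{poly int}]. The splitting [[d + r + 2] = [r + 1]
    + q^(r + 1) [d + 1]] matches the two summands of the q-Pascal rule. *)
Lemma gauss_qfact d r : gauss (d + r) r * (qfact d * qfact r) = qfact (d + r).
Proof.
elim: r d => [|r IHr] d.
  by rewrite gauss0 addn0 qfact0 mulr1 mul1r.
elim: d => [|d IHd].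
  rewrite add0n gaussS (gauss_small (ltnSn r)) mulr0 addr0 qfactS.
  by have := IHr 0%N; rewrite add0n => {2}<-; rewrite !mulrA.
have eq_dr : (d + r.+1 = d.+1 + r)%N by lia.
have numD : \sum_(0 <= i < (d + r.+1).+1) 'X^i = \sum_(0 <= i < r.+1) 'X^i
    + 'X^(r.+1) * \sum_(0 <= i < d.+1) 'X^i :> {poly int}.
  by rewrite -qnumD; congr (\sum_(0 <= i < _) _); lia.
rewrite addSn gaussS [RHS]qfactS numD mulrDr -{2}IHd eq_dr -(IHr d.+1).
rewrite (qfactS d) (qfactS r); ring.
Qed.

(** Each factor is 1 plus a multiple of ['X], so its value at 0 is 1. *)
Lemma qfact_neq0 r : qfact r != 0.
Proof.
elim: r => [|r IHr]; first by rewrite qfact0 oner_neq0.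
rewrite qfactS mulf_neq0 // -add1n qnumD big_nat1 expr0 expr1.
apply/eqP => /(congr1 (fun p => p.[0])).
by rewrite hornerD hornerM hornerX mul0r addr0 hornerC horner0 => /eqP;
  rewrite oner_eq0.
Qed.

Lemma qbinom_gauss a r : (r <= a)%N -> qbinom a r = tofrac (gauss a r).
Proof.
move=> le_ra; have := gauss_qfact (a - r) r; rewrite subnK // => qfact_a.
by rewrite /qbinom -qfact_a !tofracM mulfK // mulf_neq0 ?tofrac_eq0 ?qfact_neq0.
Qed.

Lemma qbinom_sym a r : (r <= a)%N -> qbinom a (a - r) = qbinom a r.
Proof. by move=> le_ra; rewrite /qbinom subKn // [X in _ / X]mulrC. Qed.

(** * One-line notation and insertion of a last entry *)

Section Oneline.
Local Open Scope nat_scope.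

Lemma onelineE n (s : 'S_n) i (lt_in : i < n) : oneline s i.+1 = (s (Ordinal lt_in)).+1.
Proof. by rewrite /oneline /= insubT. Qed.

Lemma oneline_bounds n (s : 'S_n) i : 0 < i <= n -> 0 < oneline s i <= n.
Proof. by case: i => [//|i] lt_in; rewrite (onelineE s lt_in) /=. Qed.

Lemma oneline_lift_max n (s : 'S_n) (j : 'I_n.+1) :
  oneline (lift_perm ord_max j s) n.+1 = j.+1.
Proof.
rewrite (onelineE _ (ltnSn n)); congr (_.+1).
have -> : Ordinal (ltnSn n) = ord_max by apply: val_inj.
by rewrite lift_perm_id.
Qed.

(** [bump j] raises the values from [j] on to make room for the new last value; [.-1] and [.+1]
    convert between values counted from 1 and from 0. *)
Lemma oneline_lift n (s : 'S_n) (j : 'I_n.+1) i : 0 < i <= n ->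
  oneline (lift_perm ord_max j s) i = (bump j (oneline s i).-1).+1.
Proof.
case: i => [//|i] /= lt_in; rewrite (onelineE _ (leqW lt_in)) (onelineE _ lt_in).
have -> : Ordinal (leqW lt_in) = lift ord_max (Ordinal lt_in).
  by apply: val_inj; rewrite /= /bump leqNgt lt_in.
by rewrite lift_perm_lift.
Qed.

Lemma lenE n (s : 'S_n) : len s = \sum_(x < n) \sum_(y < n) ((x < y) && (s y < s x)).
Proof.
rewrite /len -sum1dep_card big_mkcond /= pair_big /=.
by apply: eq_bigr => p _; case: ifP.
Qed.

Lemma count_ge n j : j <= n -> \sum_(x < n) (j <= x) = n - j.
Proof.
move=> le_jn; rewrite -(big_mkord xpredT (fun x => nat_of_bool (j <= x))).
rewrite (big_cat_nat (n := j)) //= big_nat big1 => [|i]; last by lia.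
rewrite add0n (eq_big_nat _ _ (F2 := fun=> 1)); last by move=> i; lia.
by rewrite sum_nat_const_nat; lia.
Qed.

Lemma mem_inv_h n h (s : 'S_n) i j : ((i, j) \in inv_h h s) =
  [&& 0 < i, i < j, j <= n, j <= h i & oneline s j < oneline s i].
Proof.
rewrite /inv_h !inE /=.
have -> : ((i, j) \in [seq (i, j) | i <- iota 1 n, j <- iota 1 n]) =
  (0 < i <= n) && (0 < j <= n).
  apply/allpairsP/idP => [[[a b] /= [+ + [-> ->]]]|/andP[Hi Hj]].
    by rewrite !mem_iota; lia.
  by exists (i, j); rewrite !mem_iota; split => //; lia.
lia.
Qed.
End Oneline.

(** The new inversions pair the last position with the entries of [s] that are at least [j], counted
    from 0; as [s] is a bijection, there are [n - j] of them. *)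
Lemma len_lift n (s : 'S_n) (j : 'I_n.+1) :
  len (lift_perm ord_max j s) = (len s + (n - j))%N.
Proof.
rewrite !lenE big_ord_recr /= [X in (_ + X)%N]big1 ?addn0; last first.
  by move=> y _; rewrite ltnNge -ltnS ltn_ord.
transitivity (\sum_(x < n) (\sum_(y < n) ((x < y) && (s y < s x)) + (j <= s x)))%N.
  apply: eq_bigr => x _; rewrite big_ord_recr /=.
  have wE (y : 'I_n) : widen_ord (leqnSn n) y = lift ord_max y.
    by apply: val_inj; rewrite /= /bump leqNgt ltn_ord.
  congr (_ + _)%N.
    apply: eq_bigr => y _; rewrite !wE !lift_perm_lift /= /bump.
    congr (nat_of_bool (_ && _)); lia.
  rewrite wE lift_perm_lift lift_perm_id ltn_ord /= /bump.
  congr (nat_of_bool _); lia.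
rewrite big_split /=; congr (_ + _)%N.
have le_jn : (j <= n)%N by rewrite -ltnS ltn_ord.
rewrite -(count_ge le_jn) (reindex_inj (@perm_inj _ s^-1)).
by apply: eq_bigr => x _; rewrite permKV.
Qed.

(** Insertion of a last value is injective, and both index sets have [(n + 1)!] elements. *)
Lemma sum_lift_perm (R : nmodType) n (F : 'S_n.+1 -> R) :
  \sum_s F s = \sum_(j < n.+1) \sum_(s : 'S_n) F (lift_perm ord_max j s).
Proof.
rewrite pair_big /= (reindex (fun p : 'I_n.+1 * 'S_n => lift_perm ord_max p.1 p.2)) //=.
apply: onW_bij; apply: inj_card_bij => [[j s] [k t] /= eq_st|].
  have eq_jk : j = k by have := lift_perm_id ord_max j s; rewrite eq_st lift_perm_id.
  congr (_, _) => //; apply/permP => x.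
  have := lift_perm_lift ord_max j s x.
  by rewrite eq_st eq_jk lift_perm_lift => /lift_inj.
by rewrite card_prod !card_Sn card_ord factS.
Qed.


(** * Permutations with inversion set [S] increase after position [m] *)

Section IncreasingTail.
Variables (h : nat -> nat) (S : {fset nat * nat}).
Hypothesis h_gt : forall i, (0 < i)%N -> (i < h i)%N.
Local Notation m := (max_descent S).

(** A descent at [i] would put [(i, i + 1)] into [S], because [i + 1 <= h i], against the maximality
    of [m]. *)
Lemma oneline_ltS n (s : 'S_n) i : inv_h h s = S -> (m < i < n)%N ->
  (oneline s i < oneline s i.+1)%N.
Proof.
move=> invS /andP[lt_mi lt_in]; rewrite ltnNge; apply/negP => le_s.
have neq_s : oneline s i != oneline s i.+1.
  case: i lt_mi lt_in le_s => [//|i] _ lt_in _.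
  rewrite (onelineE _ (ltnW lt_in)) (onelineE _ lt_in) eqSS.
  by rewrite (inj_eq val_inj) (inj_eq perm_inj) -val_eqE /= neq_ltn ltnSn.
have iS : (i, i.+1) \in S.
  rewrite -invS mem_inv_h; have := @h_gt i; lia.
have : (i <= m)%N.
  exact: (@leq_bigmax_seq _ _ (fun p => p.2 == p.1.+1) (fun p => p.1) _ iS (eqxx _)).
by lia.
Qed.

Lemma oneline_le n (s : 'S_n) i j : inv_h h s = S -> (m < i)%N -> (i <= j <= n)%N ->
  (oneline s i <= oneline s j)%N.
Proof.
move=> invS lt_mi /andP[]; elim: j => [|j IHj]; first by case: i lt_mi.
rewrite leq_eqVlt => /predU1P[-> //|le_ij lt_jn].
by have := @oneline_ltS n s j invS; have := IHj le_ij (ltnW lt_jn); lia.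
Qed.

(** The entries after position [m] are increasing positive integers. The case [i = M - m] yields the
    lower limit of the sum over [k]. *)
Lemma oneline_ge n (s : 'S_n) i : inv_h h s = S -> (m + i <= n)%N ->
  (i <= oneline s (m + i))%N.
Proof.
move=> invS; elim: i => [//|i IHi]; rewrite addnS => lt_in.
case: i IHi lt_in => [_ lt_mn|i IHi lt_in].
  by have /andP[] := @oneline_bounds n s (m + 0).+1 lt_mn.
by have := @oneline_ltS n s (m + i.+1) invS; have := IHi (ltnW lt_in); lia.
Qed.

(** If [m < i], the pair would be an inversion inside the increasing tail of the permutation that
    witnesses admissibility. *)
Lemma admissible_le (i j : nat) : admissible h S -> (i, j) \in S ->
  (0 < i <= m)%N /\ (j <= h i)%N.
Proof.
move=> [n [s defS]] ijS.
have : (i, j) \in inv_h h s by rewrite -defS.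
rewrite mem_inv_h => /and5P[i0 ij jn jh lt_s].
split=> //; rewrite i0 /= leqNgt; apply/negP => lt_mi.
by have := @oneline_le n s i j (esym defS) lt_mi; lia.
Qed.

Hypothesis h_mono : forall i j, (0 < i)%N -> (i <= j)%N -> (h i <= h j)%N.
Hypothesis S_adm : admissible h S.
Hypothesis S_neq0 : S <> fset0.
Local Notation M := (h m).

Lemma max_descent_gt0 : (0 < m)%N.
Proof.
have [[i j] ijS] : exists p, p \in S by apply/fset0Pn/eqP.
by have [] := admissible_le S_adm ijS; lia.
Qed.

(** [bump j] preserves the order of the old entries, so pairs [(a, b)] with [b <= n] are unaffected.
    A pair [(a, n + 1)] in [Ph h] has [m < a], since [h a <= M <= n] for [0 < a <= m]. As [s]
    increases after [m], none of these pairs is an inversion exactly when the last step is an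
    ascent, that is, [oneline s n <= j]. *)
Lemma inv_h_lift n (s : 'S_n) (j : 'I_n.+1) : (M <= n)%N ->
  (inv_h h (lift_perm ord_max j s) == S) =
  (inv_h h s == S) && (oneline s n <= j)%N.
Proof.
move=> le_Mn; have m0 := max_descent_gt0; have mM := h_gt m0.
have S_small a b : (a, b) \in S -> [&& 0 < a, a <= m & b <= M]%N.
  by move=> /(admissible_le S_adm)[]; have := @h_mono a m; lia.
set t := lift_perm _ _ _.
have tE a : (0 < a <= n)%N -> oneline t a = (bump j (oneline s a).-1).+1.
  exact: oneline_lift.
have tn : oneline t n.+1 = j.+1 by exact: oneline_lift_max.
have sb a : (0 < a <= n)%N -> (0 < oneline s a)%N.
  by move=> /(oneline_bounds s)/andP[].
have inv_restr a b : (b <= n)%N ->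
    ((a, b) \in inv_h h t) = ((a, b) \in inv_h h s).
  move=> le_bn; rewrite !mem_inv_h.
  case: (ltnP 0 a) => //= a0; case: (ltnP a b) => //= ab.
  rewrite le_bn (leqW le_bn) /= !tE; [|lia|lia].
  have := sb a; have := sb b; rewrite /bump; case: (leqP b (h a)) => //=; lia.
apply/eqP/andP => [invt|[/eqP invs le_sj]].
  split.
    apply/eqP/fsetP => -[a b]; case: (leqP b n) => [le_bn|lt_nb].
      by rewrite -inv_restr // invt.
    rewrite mem_inv_h; apply/idP/idP; first by lia.
    by move/S_small; lia.
  have := @oneline_ltS _ t n invt; rewrite tn tE /bump; [|lia].
  by have := sb n; lia.
apply/fsetP => -[a b]; case: (leqP b n) => [le_bn|lt_nb].
  by rewrite inv_restr // invs.
apply/idP/idP => [|/S_small]; last by lia.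
rewrite mem_inv_h => /and5P[a0 ab bn bh lt_t].
have eqb : b = n.+1 by lia.
have lt_ma : (m < a)%N.
  by rewrite ltnNge; apply/negP => le_am; have := @h_mono a m a0 le_am; lia.
have := @oneline_le _ s a n invs lt_ma.
move: lt_t; rewrite eqb tn tE /bump; last by lia.
have := sb a; lia.
Qed.

(** * The recursion for [tail_poly] and its solution *)

(* D(n, k, v) of the header. *)
Definition tail_poly n k v : {poly int} :=
  \sum_(s : 'S_n | [&& inv_h h s == S, oneline s M == k & oneline s n <= v]%N) 'X^(len s).

Lemma tail_polyS n k v : (M <= n)%N -> (v <= n.+1)%N ->
  tail_poly n.+1 k v = \sum_(0 <= j < v) 'X^(n - j) * tail_poly n k j.
Proof.
move=> le_Mn le_vn; have m0 := max_descent_gt0; have mM := h_gt m0.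
rewrite /tail_poly [LHS]big_mkcond sum_lift_perm big_mkord.
rewrite (big_ord_widen n.+1 (fun j => 'X^(n - j) * tail_poly n k j) le_vn).
rewrite [RHS]big_mkcond; apply: eq_bigr => j _.
transitivity (\sum_(s : 'S_n) if [&& inv_h h s == S, oneline s M == k,
    oneline s n <= j & j < v]%N then 'X^(n - j) * 'X^(len s) else 0 : {poly int}).
  apply: eq_bigr => s _; rewrite inv_h_lift // oneline_lift_max len_lift.
  rewrite -exprD addnC -!andbA; case: eqP => //= invS.
  congr (if _ then _ else _); case: (leqP (oneline s n) j) => //=; last by rewrite andbF.
  (* The entry at [M] is at most the last one, hence at most [j]; counted from 0 it is below [j],
     and [bump j] fixes it. *)
  move=> le_sj; have := @oneline_le n s M n invS mM; rewrite le_Mn leqnn => /(_ isT) le_s.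
  rewrite oneline_lift /bump; last by lia.
  have := @oneline_bounds n s M; lia.
case: ifP => lt_jv; last first.
  by rewrite big1 // => s _; rewrite !andbF.
rewrite /tail_poly mulr_sumr [RHS]big_mkcond; apply: eq_bigr => s _.
by rewrite andbT.
Qed.

Lemma tail_poly_small n k v : (M <= n)%N -> (v < k)%N -> tail_poly n k v = 0.
Proof.
move=> le_Mn lt_vk; apply: big_pred0 => s; apply/negP => /and3P[/eqP invS /eqP sM sn].
have := @oneline_le n s M n invS; have := h_gt max_descent_gt0; lia.
Qed.

(** At size [M] the last entry is the entry at position [M], so the bound [v] is automatic. *)
Lemma tail_poly_base k v : (k <= v)%N -> tail_poly M k v = b_poly h S k.
Proof.
move=> le_kv; apply: eq_bigl => s; rewrite !inE.
case: eqP => //= _; case: eqP => [->|] //; exact: le_kv.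
Qed.

Lemma tail_polyE r k a : (k + a <= M + r)%N ->
  tail_poly (M + r) k (k + a) =
  b_poly h S k * 'X^(r * (M + r - k - a)) * gauss a r.
Proof.
elim: r a => [|r IHr] a.
  by rewrite addn0 => le_kaM; rewrite tail_poly_base ?leq_addr // gauss0 !mulr1.
elim: a => [|a IHa] le_ka.
  rewrite addn0 addnS in le_ka *; rewrite tail_polyS ?leq_addr //= mulr0.
  (* For [a = 0] every term has [j < k] and vanishes, as does [gauss 0 r.+1]. *)
  rewrite big_nat big1 // => j /andP[_ lt_jk].
  by rewrite tail_poly_small ?mulr0 // leq_addr.
rewrite !addnS tail_polyS ?leq_addr //; last by lia.
(* Split off [j = k + a]; the remaining terms refold into the value at [k + a] for the same size,
   which [IHa] gives. *)
rewrite big_nat_recr //= -tail_polyS ?leq_addr //; last by lia.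
rewrite -addnS IHa; last by lia.
rewrite IHr; last by lia.
have -> : (M + r.+1 - k - a = (M + r - k - a).+1)%N by lia.
have -> : (M + r.+1 - k - a.+1 = M + r - k - a)%N by lia.
rewrite -subnDA; set e := (_ - _)%N.
(* The surplus ['X^(r.+1)] is the factor in the q-Pascal rule. *)
have -> : 'X^(r.+1 * e.+1) = 'X^e * 'X^(r * e) * 'X^(r.+1) :> {poly int}.
  by rewrite -!exprD; congr ('X^_); lia.
have -> : 'X^(r.+1 * e) = 'X^e * 'X^(r * e) :> {poly int}.
  by rewrite -exprD; congr ('X^_); lia.
rewrite mulrDr; ring.
Qed.

Lemma b_poly_small k : (k < M - m)%N -> b_poly h S k = 0.
Proof.
move=> lt_k; apply: big_pred0 => s; rewrite !inE; apply/negP => /andP[/eqP invS /eqP sM].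
have mM := h_gt max_descent_gt0.
have := @oneline_ge M s (M - m) invS; rewrite subnKC ?(ltnW mM) // sM; lia.
Qed.

Lemma b_poly_large k : (M < k)%N -> b_poly h S k = 0.
Proof.
move=> lt_k; apply: big_pred0 => s; rewrite !inE; apply/negP => /andP[_ /eqP sM].
have := h_gt max_descent_gt0; have := @oneline_bounds M s M; lia.
Qed.

Lemma I_polyE n : (M <= n)%N ->
  I_poly h S n = \sum_(M - m <= k < M.+1) b_poly h S k * gauss (n - k) (n - M).
Proof.
move=> le_Mn; have m0 := max_descent_gt0; have mM := h_gt m0.
transitivity (\sum_(0 <= k < n.+1) tail_poly n k n).
  rewrite big_mkord /tail_poly /I_poly.
  (* Group by the entry at position [M]; it is at most [n], so [inord] keeps its value. *)
  rewrite (partition_big (fun s : 'S_n => inord (oneline s M) : 'I_n.+1) xpredT) //=.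
  apply: eq_bigr => k _; apply: eq_bigl => s; rewrite inE; congr (_ && _).
  have := @oneline_bounds n s M; have := @oneline_bounds n s n.
  rewrite -val_eqE /= => sn sM; rewrite inordK; last by lia.
  by rewrite [X in _ && X](_ : _ = true) ?andbT //; lia.
have -> : \sum_(0 <= k < n.+1) tail_poly n k n =
    \sum_(0 <= k < n.+1) b_poly h S k * gauss (n - k) (n - M).
  apply: eq_big_nat => k /andP[_]; rewrite ltnS => le_kn.
  (* With [r = n - M] and [a = n - k] the exponent of ['X] is 0. *)
  have := @tail_polyE (n - M) k (n - k).
  rewrite (subnKC le_Mn) (subnKC le_kn) subnn muln0 mulr1; exact.
rewrite (big_cat_nat (n := M - m)) //=; last by lia.
rewrite big_nat big1 => [|k /andP[_ lt_k]]; last by rewrite b_poly_small ?mul0r.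
rewrite add0r (big_cat_nat (n := M.+1)) //=; last by lia.
rewrite [X in _ + X]big_nat [X in _ + X]big1 ?addr0 // => k /andP[lt_k _].
by rewrite b_poly_large ?mul0r.
Qed.

End IncreasingTail.

Unset Implicit Arguments.

Theorem theorem5p4 (h : nat -> nat)
  (h_pos : forall i : nat, (0 < i)%N -> (0 < h i)%N)
  (h_mono : forall i j : nat, (0 < i)%N -> (i <= j)%N -> (h i <= h j)%N)
  (h_gt : forall i : nat, (0 < i)%N -> (i < h i)%N)
  (S : {fset nat * nat}) (S_neq0 : S <> fset0) (S_adm : admissible h S)
  (m : nat) (m_def : m = max_descent S)
  (n : nat) (n_ge : (h m <= n)%N) :
  tofrac (I_poly h S n) =
    \sum_(h m - m <= k < (h m).+1)
      tofrac (b_poly h S k) * qbinom (n - k) (h m - k)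
  /\
  \sum_(h m - m <= k < (h m).+1)
      tofrac (b_poly h S k) * qbinom (n - k) (h m - k) =
    \sum_(0 <= l < m.+1)
      tofrac (b_poly h S (h m - l)) * qbinom (n - h m + l) l.
Proof.
have m0 : (0 < m)%N by rewrite m_def; apply: (@max_descent_gt0 h).
have mM := h_gt m m0; subst m; split.
  rewrite (@I_polyE h S) // rmorph_sum; apply: eq_big_nat => k /andP[_ le_kM].
  rewrite rmorphM /= -qbinom_gauss; last by lia.
  (* Symmetry applies because [(n - k) - (n - h m) = h m - k]. *)
  by rewrite -qbinom_sym; [congr (_ * qbinom _ _)|]; lia.
(* Substitute [k = h m - l]; the subtraction is exact since [l <= m < h m]. *)
rewrite big_nat_rev /= -{1}[(h _ - _)%N]add0n big_addn.
have -> : ((h (max_descent S)).+1 - (h (max_descent S) - max_descent S)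
           = (max_descent S).+1)%N by lia.
apply: eq_big_nat => l /andP[_ le_lm].
have -> : (h (max_descent S) - max_descent S + (h (max_descent S)).+1
  - (l + (h (max_descent S) - max_descent S)).+1 = h (max_descent S) - l)%N by lia.
by congr (_ * qbinom _ _); lia.
Qed.
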